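(* Let $s_1,s_2,s_3$ be the three roots in $y$ of $H(x,y)=y^3-x(1+xy+y^2)(1+y^2+y^4)$ that are finite as $x\to0$ (they vanish at $x=0$), and let $$D(x)=\sum_{y\in\{s_1,s_2,s_3\}}\frac{y^2+x(1+y^2+y^4)}{3y^2-2xy(2+4y^2+3y^4)-x^2(1+3y^2+5y^4)}.$$ Then, as formal power series in $x$ with Laurent polynomial coefficients in $y$, $$\sum_{n\ge0}\sum_{m\in\mathbb{Z}}C^{H}_{R}(n,m)x^ny^m=\frac{y^3}{y^3-x(1+xy+y^2)(1+y^2+y^4)},\qquad \sum_{n\ge0}\sum_{m\in\mathbb{Z}}C^{H}(n,m)x^ny^m=\frac{y(1+y^2+y^4)}{y^3-x(1+xy+y^2)(1+y^2+y^4)},$$ $$\sum_{n\ge0}C^{H}_{R}(n,0)x^n=\frac{D(x)+D(-x)}{2},\qquad \sum_{n\ge0}C^{H}(n,0)x^n=\frac{D(x)-D(-x)}{2x}.$$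
   Context: A lattice path is a finite sequence of steps (vectors in $\mathbb{Z}^2$) starting at $(0,0)$; its vertices are the partial sums, and it terminates at the last vertex (the empty path terminates at $(0,0)$). Let $S_C=\{(1,1),(1,-1),(2,0)\}$ and $S_{CW}=S_C\cup\{(0,2),(0,-2)\}$; $(0,\pm2)$ are vertical steps. A vertically constrained $S_{CW}$ path is a lattice path with steps in $S_{CW}$ with no two consecutive vertical steps. $C^{H}(n,m)$ is the number of vertically constrained $S_{CW}$ paths from $(0,0)$ to $(n,m)$, and $C^{H}_{R}(n,m)$ the number of those whose first step (if any) lies in $S_C$. *)

(* Defs.v *)
From HB Require Import structures.
From mathcomp Require Import all_boot all_order all_algebra finmap.
From mathcomp Require Import boolp classical_sets functions cardinality fsbigop.
From mathcomp Require Import zify.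

Set Implicit Arguments.
Unset Strict Implicit.
Unset Printing Implicit Defensive.

Import Order.TTheory GRing.Theory Num.Theory.
Local Open Scope classical_set_scope.
Local Open Scope ring_scope.

Definition SC : seq (int * int) := [:: (1, 1); (1, -1); (2, 0)].
Definition SV : seq (int * int) := [:: (0, 2); (0, -2)].
Definition SCW : seq (int * int) := SC ++ SV.

(* [sorted r] only compares adjacent entries: no two consecutive steps are
   both vertical. *)
Definition vconstrained (p : seq (int * int)) : bool :=
  all (mem SCW) p && sorted (fun s t => ~~ ((s \in SV) && (t \in SV))) p.

Definition starts_in_SC (p : seq (int * int)) : bool :=
  if p is s :: _ then s \in SC else true.

Definition endpoint (p : seq (int * int)) : int * int := \sum_(s <- p) s.

Definition pathsH (n : nat) (m : int) : set (seq (int * int)) :=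
  [set p | vconstrained p /\ endpoint p = (n%:Z, m)].
Definition pathsHR (n : nat) (m : int) : set (seq (int * int)) :=
  [set p | [/\ vconstrained p, starts_in_SC p & endpoint p = (n%:Z, m)]].

(* [fset_set] is set to be empty on infinite sets; [pathsH_finite] and
   [pathsHR_finite] show that this never happens. *)
Definition CH (n : nat) (m : int) : nat := (#|` fset_set (pathsH n m)|)%fset.
Definition CHR (n : nat) (m : int) : nat := (#|` fset_set (pathsHR n m)|)%fset.

Lemma endpoint_cons s p : endpoint (s :: p) = s + endpoint p.
Proof. by rewrite /endpoint big_cons. Qed.

Lemma vconstrained_bound (p : seq (int * int)) : vconstrained p ->
  (size p)%:Z <= 2 * (endpoint p).1 + 1 /\ `|(endpoint p).2| <= 2 * (size p)%:Z.
Proof.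
move=> /andP[pS pV].
suff [] : [/\ (size p)%:Z <= 2 * (endpoint p).1
                 + (if p is s :: _ then (s \in SV)%:R else 0) &
              `|(endpoint p).2| <= 2 * (size p)%:Z].
  move=> h1 h2; split => //; apply: le_trans h1 _.
  by rewrite lerD2l; case: (p) => // s q; case: (_ \in _).
elim: p pS pV => [|s p IH]; first by rewrite /endpoint big_nil.
rewrite /= => /andP[sS pS] psp.
have /(IH pS)[IH1 IH2] := path_sorted psp.
rewrite endpoint_cons.
have -> : (s + endpoint p).1 = s.1 + (endpoint p).1 by [].
have -> : (s + endpoint p).2 = s.2 + (endpoint p).2 by [].
have hv : (s \in SV) -> (if p is t :: _ then (t \in SV)%:R else 0 : int) = 0.
  by move=> sV; case: (p) psp => //= t q /andP[]; rewrite sV /= => /negPf->.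
have le1 : (if p is t :: _ then (t \in SV)%:R else 0 : int) <= 1.
  by case: (p) => // t q; case: (_ \in _).
move: IH1 IH2 hv le1;
set b : int := if p is _ :: _ then _ else _.
move: (endpoint p).1 (endpoint p).2 (size p) b => e1 e2 k b {pS psp IH}.
move: sS; rewrite /SCW /SC /SV !inE.
case/or4P => [/eqP->|/eqP->|/eqP->|/orP[]/eqP->] //= IH1 IH2 hv le1;
  first [move: (hv isT) => {}hv | clear hv]; split; lia.
Qed.

Fixpoint seqs_upto (T : Type) (k : nat) (A : seq T) : seq (seq T) :=
  if k is k'.+1 then
    [::] :: [seq a :: s | a <- A, s <- seqs_upto k' A] else [:: [::]].

Lemma mem_seqs_upto (T : eqType) (A : seq T) k p :
  all (mem A) p -> (size p <= k)%N -> p \in seqs_upto k A.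
Proof.
elim: k p => [|k IH] [|a p] //= /andP[aA pA] sp.
rewrite inE /=; apply/allpairsP; exists (a, p) => /=; split => //.
exact: IH.
Qed.

Lemma pathsH_finite n m : finite_set (pathsH n m).
Proof.
apply: (@sub_finite_set _ _ [set` seqs_upto (2 * n).+1 SCW]) => //.
move=> p [vp ep]; have [] := vconstrained_bound vp; rewrite ep /= => h _.
have sp : (size p <= (2 * n).+1)%N by move: (size p) h => k; lia.
by case/andP: vp => pS _; exact: mem_seqs_upto pS sp.
Qed.

Lemma pathsHR_finite n m : finite_set (pathsHR n m).
Proof. by apply: sub_finite_set (@pathsH_finite n m) => p []. Qed.

Lemma card_paths_supp (P : int -> set (seq (int * int))) n m :
  P m `<=` pathsH n m -> (#|` fset_set (P m)|)%fset != 0%N ->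
  `|m| <= 2 * (2 * n%:Z + 1).
Proof.
move=> sP; rewrite cardfs_eq0 => /fset0Pn[p].
rewrite in_fset_set ?inE; last exact: sub_finite_set sP (pathsH_finite _ _).
move=> /sP[vp ep]; have [] := vconstrained_bound vp; rewrite ep /=; lia.
Qed.

Lemma finite_int_interval (k : int) : finite_set [set m : int | `|m| <= k].
Proof.
pose r : seq int := [seq i%:Z - k | i <- iota 0 (2 * `|k|%N).+1].
apply: (@sub_finite_set _ _ [set` r]) => // m' mk.
have {mk}: `|m' : int| <= k by []; move: (m' : int) => m {m'} mk.
apply/mapP; exists (absz (m + k)); last by lia.
by rewrite mem_iota; lia.
Qed.

Lemma CH_finite_support n : finite_set [set m | CH n m != 0%N].
Proof.
apply: sub_finite_set (finite_int_interval (2 * (2 * n%:Z + 1))) => m.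
by apply: (@card_paths_supp (pathsH n)).
Qed.

Lemma CHR_finite_support n : finite_set [set m | CHR n m != 0%N].
Proof.
apply: sub_finite_set (finite_int_interval (2 * (2 * n%:Z + 1))) => m.
by apply: (@card_paths_supp (pathsHR n)) => p [].
Qed.

(* Laurent polynomials in one variable: finitely supported functions on int
   with the convolution product. *)
Record laurent (R : nmodType) := Laurent {
  lcoef :> int -> R;
  lcoef_finite : finite_set [set m | lcoef m != 0] }.

HB.instance Definition _ R := gen_eqMixin (laurent R).
HB.instance Definition _ R := gen_choiceMixin (laurent R).

Lemma laurentP (R : nmodType) (f g : laurent R) : f =1 g -> f = g.
Proof.
case: f g => f Pf [g Pg] /= /funext fg; case: _ / fg Pg => Pg.
by rewrite (Prop_irrelevance Pf Pg).
Qed.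

Section LaurentZmod.
Variable R : zmodType.
Implicit Types f g h : laurent R.

Fact lzero_finite : finite_set [set m : int | (0 : R) != 0].
Proof. by apply: (@sub_finite_set _ _ set0) => // m /=; rewrite eqxx. Qed.
Definition lzero : laurent R := Laurent lzero_finite.

Fact ladd_finite f g : finite_set [set m | f m + g m != 0].
Proof.
apply: (@sub_finite_set _ _ ([set m | f m != 0] `|` [set m | g m != 0])).
  move=> m /=; have [->|?] := eqVneq (f m) 0; last by left.
  by rewrite add0r; right.
by rewrite finite_setU; split; exact: lcoef_finite.
Qed.
Definition ladd f g : laurent R := Laurent (ladd_finite f g).

Fact lopp_finite f : finite_set [set m | - f m != 0].
Proof.
by apply: sub_finite_set (lcoef_finite f) => m /=; rewrite oppr_eq0.
Qed.
Definition lopp f : laurent R := Laurent (lopp_finite f).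

Fact laddA : associative ladd.
Proof. by move=> f g h; apply: laurentP => m /=; rewrite addrA. Qed.
Fact laddC : commutative ladd.
Proof. by move=> f g; apply: laurentP => m /=; rewrite addrC. Qed.
Fact ladd0 : left_id lzero ladd.
Proof. by move=> f; apply: laurentP => m /=; rewrite add0r. Qed.
Fact laddN : left_inverse lzero lopp ladd.
Proof. by move=> f; apply: laurentP => m /=; rewrite addNr. Qed.

HB.instance Definition _ :=
  GRing.isZmodule.Build (laurent R) laddA laddC ladd0 laddN.

Fact lmono_finite (k : int) (a : R) :
  finite_set [set m : int | (if m == k then a else 0) != 0].
Proof.
apply: (@sub_finite_set _ _ [set k]) => // m /=.
by case: (eqVneq m k) => // _; rewrite eqxx.
Qed.
(* The monomial a y^k. *)
Definition lmono (k : int) (a : R) : laurent R := Laurent (lmono_finite k a).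

End LaurentZmod.

Section LaurentRing.
Variable R : comNzRingType.
Implicit Types f g h : laurent R.

Definition lsupp f : {fset int} := fset_set [set m | f m != 0].

Lemma lsuppP f m : f m != 0 -> m \in lsupp f.
Proof. by move=> fm; rewrite in_fset_set ?inE//; exact: lcoef_finite. Qed.

Definition lconv f g (k : int) : R := \sum_(i \in [set: int]) f i * g (k - i).

Lemma fsumTE (F : int -> R) (A : {fset int}) :
  (forall i, F i != 0 -> i \in A) -> \sum_(i \in [set: int]) F i = \sum_(i <- A) F i.
Proof.
by move=> FA; apply: fsbigTE => i iA; apply/eqP; apply: contraNT iA => /FA.
Qed.

Lemma lconvE f g k (A : {fset int}) : (forall i, f i != 0 -> i \in A) ->
  lconv f g k = \sum_(i <- A) f i * g (k - i).
Proof.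
move=> fA; apply: fsumTE => i Hi; apply: fA; apply: contraNneq Hi => ->.
by rewrite mul0r.
Qed.

Lemma lconv_finite f g : finite_set [set k | lconv f g k != 0].
Proof.
apply: (@sub_finite_set _ _ [set` [seq i + j | i <- lsupp f, j <- lsupp g]]) => //.
move=> k /=; apply: contraNT => nk.
rewrite (lconvE _ _ (@lsuppP f)) big_seq big1// => i fi.
have [->|gi] := eqVneq (g (k - i)) 0; first by rewrite mulr0.
case/negP: nk; apply/allpairsP; exists (i, k - i) => /=; split => //.
  exact: lsuppP.
by rewrite addrC subrK.
Qed.
Definition lmul f g : laurent R := Laurent (lconv_finite f g).

Fact lmulC : commutative lmul.
Proof.
move=> f g; apply: laurentP => k /=; rewrite /lconv.
rewrite (reindex_fsbigT (fun i => k - i)) /=; last first.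
  by exists (fun i => k - i) => i; rewrite subKr.
by apply: eq_fsbigr => i _; rewrite subKr mulrC.
Qed.

Fact lmulA : associative lmul.
Proof.
move=> f g h; apply: laurentP => k /=.
pose B := [fset (i + j)%R | i in lsupp f, j in lsupp g]%fset.
have fgB i j : f i != 0 -> g j != 0 -> i + j \in B.
  by move=> fi gj; apply/imfset2P; exists i; rewrite ?lsuppP//=; exists j; rewrite ?lsuppP.
rewrite (lconvE _ _ (@lsuppP f)) (@lconvE _ _ _ B); last first.
  move=> m /=; apply: contraNT => mB.
  rewrite (lconvE _ _ (@lsuppP f)) big1// => i _.
  have [->|fi] := eqVneq (f i) 0; first by rewrite mul0r.
  have [->|gi] := eqVneq (g (m - i)) 0; first by rewrite mulr0.
  by case/negP: mB; rewrite -(subrK i m) addrC fgB.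
under [RHS]eq_bigr => j _ do rewrite /= (lconvE _ _ (@lsuppP f)) mulr_suml.
rewrite exchange_big /=; apply: eq_bigr => i _.
have [->|fi] := eqVneq (f i) 0.
  by rewrite mul0r big1// => j _; rewrite !mul0r.
under eq_bigr => j _ do rewrite -mulrA.
rewrite -mulr_sumr; congr (_ * _).
rewrite -(@fsumTE (fun j => g (j - i) * h (k - j))); last first.
  move=> j; apply: contraNT => jB.
  have [->|gi] := eqVneq (g (j - i)) 0; first by rewrite mul0r.
  by case/negP: jB; rewrite -(subrK i j) addrC fgB.
rewrite (reindex_fsbigT (fun j => j + i)) /=; last first.
  by exists (fun j => j - i) => j; rewrite ?addrK ?subrK.
by apply: eq_fsbigr => j _; rewrite addrK opprD (addrC (- j)) addrA.
Qed.

Fact lmul1 : left_id (lmono 0 1) lmul.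
Proof.
move=> f; apply: laurentP => k /=; rewrite (@lconvE _ _ _ [fset 0]%fset).
  by rewrite big_seq_fset1 /= mul1r subr0.
by move=> i /=; rewrite inE; case: (i == 0) => //=; rewrite eqxx.
Qed.

Fact lmulDl : left_distributive lmul (@ladd R).
Proof.
move=> f g h; apply: laurentP => k /=.
have mA (f' : laurent R) A i : f' = f \/ f' = g -> A = (lsupp f `|` lsupp g)%fset ->
    f' i != 0 -> i \in A.
  by move=> [] -> -> /lsuppP; rewrite inE => ->; rewrite ?orbT.
pose A := (lsupp f `|` lsupp g)%fset.
rewrite (@lconvE f h k A) ?(@lconvE g h k A) ?(@lconvE (ladd f g) h k A).
- by rewrite -big_split; apply: eq_bigr => i _ /=; rewrite mulrDl.
- move=> i /=; have [->|fi _] := eqVneq (f i) 0; last by apply: (mA f) => //; left.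
  by rewrite add0r => ?; apply: (mA g) => //; right.
- by move=> i; apply: (mA g) => //; right.
- by move=> i; apply: (mA f) => //; left.
Qed.

Fact lone_neq0 : lmono 0 1 != 0 :> laurent R.
Proof.
apply/eqP => /(congr1 (fun f : laurent R => f 0)) /= /eqP.
by rewrite oner_eq0.
Qed.

HB.instance Definition _ := GRing.Zmodule_isComNzRing.Build (laurent R)
  lmulA lmulC lmul1 lmulDl lone_neq0.

End LaurentRing.

(* Formal power series, with the Cauchy product. *)
Record fps (A : Type) := FPS { fcoef : nat -> A }.

HB.instance Definition _ A := gen_eqMixin (fps A).
HB.instance Definition _ A := gen_choiceMixin (fps A).

Lemma fpsP A (f g : fps A) : fcoef f =1 fcoef g -> f = g.
Proof. by case: f g => f [g] /= /funext ->. Qed.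

Section FpsZmod.
Variable A : zmodType.
Implicit Types f g h : fps A.

Definition fadd f g := FPS (fun n => fcoef f n + fcoef g n).
Definition fopp f := FPS (fun n => - fcoef f n).
Definition fzero : fps A := FPS (fun=> 0).

Fact faddA : associative fadd.
Proof. by move=> f g h; apply: fpsP => n /=; rewrite addrA. Qed.
Fact faddC : commutative fadd.
Proof. by move=> f g; apply: fpsP => n /=; rewrite addrC. Qed.
Fact fadd0 : left_id fzero fadd.
Proof. by move=> f; apply: fpsP => n /=; rewrite add0r. Qed.
Fact faddN : left_inverse fzero fopp fadd.
Proof. by move=> f; apply: fpsP => n /=; rewrite addNr. Qed.

HB.instance Definition _ :=
  GRing.isZmodule.Build (fps A) faddA faddC fadd0 faddN.

Definition fconst (a : A) : fps A := FPS (fun n => if n is 0 then a else 0).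

End FpsZmod.

Section FpsRing.
Variable A : comNzRingType.
Implicit Types f g h : fps A.

Definition fmul f g := FPS (fun n => \sum_(i < n.+1) fcoef f i * fcoef g (n - i)%N).

Definition ftrunc N f : {poly A} := \poly_(i < N) fcoef f i.

Lemma coef_fmul N f g n : (n < N)%N ->
  fcoef (fmul f g) n = (ftrunc N f * ftrunc N g)`_n.
Proof.
move=> nN; rewrite coefM /=; apply: eq_bigr => i _.
by rewrite !coef_poly !ifT//; have := ltn_ord i; lia.
Qed.

Fact fmulC : commutative fmul.
Proof. by move=> f g; apply: fpsP => n; rewrite !(@coef_fmul n.+1)// mulrC. Qed.

Fact fmulA : associative fmul.
Proof.
move=> f g h; apply: fpsP => n; rewrite !(@coef_fmul n.+1)//.
transitivity ((ftrunc n.+1 f * (ftrunc n.+1 g * ftrunc n.+1 h))`_n).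
  rewrite !coefM; apply: eq_bigr => i _; congr (_ * _).
  by rewrite coef_poly ifT ?(@coef_fmul n.+1)// ltnS leq_subr.
rewrite mulrA !coefM; apply: eq_bigr => i _; congr (_ * _).
by rewrite [RHS]coef_poly ltn_ord (@coef_fmul n.+1).
Qed.

Fact fmul1 : left_id (fconst 1) fmul.
Proof.
move=> f; apply: fpsP => n /=; rewrite big_ord_recl /= mul1r subn0 big1 ?addr0//.
by move=> i _; rewrite mul0r.
Qed.

Fact fmulDl : left_distributive fmul (@fadd A).
Proof.
move=> f g h; apply: fpsP => n /=; rewrite -big_split /=.
by apply: eq_bigr => i _; rewrite mulrDl.
Qed.

Fact fone_neq0 : fconst 1 != 0 :> fps A.
Proof.
by apply/eqP => /(congr1 (fun f => fcoef f 0)) /= /eqP; rewrite oner_eq0.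
Qed.

HB.instance Definition _ := GRing.Zmodule_isComNzRing.Build (fps A)
  fmulA fmulC fmul1 fmulDl fone_neq0.

Definition fX : fps A := FPS (fun n => (n == 1%N)%:R).

Definition funit : {pred fps A} := [pred f | `[< exists g, g * f = 1 >]].
(* The inverse when there is one, and f itself otherwise. *)
Definition finv f : fps A :=
  if pselect (exists g, g * f = 1) is left gf then projT1 (cid gf) else f.

Fact fmulVx : {in funit, left_inverse 1 finv *%R}.
Proof.
by move=> f /asboolP uf; rewrite /finv; case: pselect => // gf; case: cid.
Qed.
Fact funitPl f g : g * f = 1 -> funit f.
Proof. by move=> gf; apply/asboolP; exists g. Qed.
Fact finv_out : {in [predC funit], finv =1 id}.
Proof. by move=> f /asboolPn nf; rewrite /finv; case: pselect. Qed.

HB.instance Definition _ := GRing.ComNzRing_hasMulInverse.Build (fps A)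
  fmulVx funitPl finv_out.

End FpsRing.
Arguments fX {A}.

Section FpsIdomain.
Variable A : idomainType.

Lemma fps_neq0 (f : fps A) : f != 0 ->
  exists2 k, fcoef f k != 0 & forall i, (i < k)%N -> fcoef f i = 0.
Proof.
move=> f0; have ex : exists k, fcoef f k != 0.
  apply/not_existsP => h; case/eqP: f0; apply: fpsP => n /=.
  by apply/eqP; apply/negPn/negP; apply: h.
exists (ex_minn ex); case: ex_minnP => // k _ mk i ik.
by apply/eqP; apply: contraTT ik => /mk; rewrite -leqNgt.
Qed.

Fact fps_integral : GRing.integral_domain_axiom (fps A).
Proof.
move=> f g; apply: contra_eqT; rewrite negb_or.
move=> /andP[/fps_neq0[k fk lk] /fps_neq0[l gl ll]].
apply/eqP => /(congr1 (fun f => fcoef f (k + l)%N)) /=.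
have kl : (k < (k + l).+1)%N by lia.
rewrite (bigD1 (Ordinal kl)) //= addKn big1; last first.
  move=> i ik; have {}ik : (i : nat) != k.
    by apply: contraNneq ik => ik; apply/eqP/val_inj.
  have [lt|ge] := ltnP i k; first by rewrite lk// mul0r.
  have ki : (k < i)%N by rewrite ltn_neqAle eq_sym ik.
  by rewrite ll ?mulr0// ltn_subLR ?ltn_add2r// -ltnS ltn_ord.
by rewrite addr0 => /eqP; rewrite mulf_eq0 (negPf fk) (negPf gl).
Qed.

HB.instance Definition _ :=
  GRing.ComUnitRing_isIntegral.Build (fps A) fps_integral.

End FpsIdomain.

(* f(-x) *)
Definition fps_subN (A : pzRingType) (f : fps A) : fps A :=
  FPS (fun n => (-1) ^+ n * fcoef f n).
(* f(x^3) *)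
Definition fps_subX3 (A : nmodType) (f : fps A) : fps A :=
  FPS (fun n => if (3 %| n)%N then fcoef f (n %/ 3) else 0).

(* The field of formal Laurent series, as the fraction field of power series. *)
Notation fls A := {fraction fps A}.
Notation "f %:F" := (FracField.tofrac f) : ring_scope.

Definition H (A : comPzRingType) (x y : A) : A :=
  y ^+ 3 - x * (1 + x * y + y ^+ 2) * (1 + y ^+ 2 + y ^+ 4).

Definition Dterm (K : fieldType) (x y : K) : K :=
  (y ^+ 2 + x * (1 + y ^+ 2 + y ^+ 4)) /
  (3 * y ^+ 2 - 2 * x * y * (2 + 4 * y ^+ 2 + 3 * y ^+ 4)
   - x ^+ 2 * (1 + 3 * y ^+ 2 + 5 * y ^+ 4)).

(* sum_(n >= 0) sum_(m in Z) c(n, m) x^n y^m as a power series in x over the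
   Laurent polynomials in y.  For each n the inner sum has finite support when
   c is CH or CHR ([CH_finite_support], [CHR_finite_support]). *)
Definition gf_xy (c : nat -> int -> nat) : fps (laurent int) :=
  FPS (fun n => \sum_(m \in [set: int]) lmono m (c n m)%:Z).

Definition gf_x (C : pzSemiRingType) (c : nat -> nat) : fps C :=
  FPS (fun n => (c n)%:R).

(* The roots in y of H(x, y) near x = 0 are Puiseux series in x^(1/3); with t
   the variable of [fls C], x stands for t^3. *)
Section Roots.
Variable C : idomainType.

Definition xt : fls C := (fX ^+ 3)%:F.

Definition finite_at0 (y : fls C) : Prop := exists u : fps C, y = u%:F.
Definition vanishes_at0 (y : fls C) : Prop :=
  exists2 u : fps C, fcoef u 0 = 0 & y = u%:F.

Definition the_finite_roots (s1 s2 s3 : fls C) : Prop :=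
  uniq [:: s1; s2; s3] /\
  forall y : fls C, (H xt y = 0 /\ finite_at0 y) <-> y \in [:: s1; s2; s3].

End Roots.
Arguments xt {C}.

(* Main.v *)
(** Splitting a path at its first step gives R = 1 + (xy + x/y + x^2) G and
    G = (1 + y^2 + y^-2) R for the two generating functions R (of C^H_R) and
    G (of C^H), hence R = y^3/H and G = y(1 + y^2 + y^4)/H.

    With x = t^3, substituting y = t z turns H = 0 into z^3 = 1 + O(t), which
    Hensel's lemma solves from each cube root of unity. So
    H = (y - s1)(y - s2)(y - s3) U with U = 1 mod t: there are no other finite
    roots, and U plays no role in the coefficient of y^-1. Lagrange interpolation
    at the s_i then gives [y^-1] N/H = sum_i N(s_i)/H_y(s_i) for every polynomial
    N. For N = y^2 + x(1 + y^2 + y^4) this is D = [y^0] R + x [y^0] G. Every step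
    changes n + m by an even number, so both constant terms are even in x and are
    the even and odd parts of D. *)

From HB Require Import structures.
Require Import Defs.
From mathcomp Require Import all_boot all_order all_algebra finmap.
From mathcomp Require Import boolp classical_sets functions cardinality fsbigop.
From mathcomp Require Import zify ring.

Set Implicit Arguments.
Unset Strict Implicit.
Unset Printing Implicit Defensive.

Import Order.TTheory GRing.Theory Num.Theory.
Local Open Scope classical_set_scope.
Local Open Scope ring_scope.

(** * Counting paths by their first step *)

(** A word is empty or has its head in [r], and removing a given head is injective, so each class of
    words is counted by its tails. *)
Lemma card_fset_set_heads (T : choiceType) (r : seq T) (A : set (seq T)) :
  uniq r -> finite_set A -> (forall s p, A (s :: p) -> s \in r) ->
  #|` fset_set A|%fset =
  (`[< A [::] >] + \sum_(s <- r) #|` fset_set [set p | A (s :: p)]|%fset)%N.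
Proof.
move=> ur finA Ar.
pose e : seq (seq T) := fset_set A.
have ue : uniq e by exact: fset_uniq.
have eE p : (p \in e) = `[< A p >].
  by rewrite /e in_fset_set//; apply/idP/asboolP; rewrite inE.
have -> : `[< A [::] >] = count_mem [::] e :> nat by rewrite count_uniq_mem// eE.
have finAs s : finite_set [set p | A (s :: p)].
  by apply: (finite_preimage (f := cons s) _ finA) => p q _ _ [].
have -> : (\sum_(s <- r) #|` fset_set [set p | A (s :: p)]|%fset =
           \sum_(s <- r) count (fun p => ohead p == Some s) e)%N.
  apply: eq_bigr => s _; rewrite -size_filter -(size_map (cons s)).
  apply: perm_size; apply: uniq_perm.
  - by rewrite map_inj_uniq; [exact: fset_uniq | move=> p q []].
  - exact: filter_uniq.
  - move=> p; rewrite mem_filter eE; apply/mapP/andP => [[q]|[]].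
      by rewrite in_fset_set// inE => /= Aq ->; rewrite eqxx; split => //; apply/asboolP.
    case: p => [//|s' q] /= /eqP[->] /asboolP Aq; exists q => //.
    by rewrite in_fset_set// inE.
rewrite -[LHS]/(size e).
have : all (fun p => if p is s :: _ then s \in r else true) e.
  by apply/allP => -[//|s p]; rewrite eE => /asboolP /Ar.
(* Each word of the enumeration adds one to exactly one term: the indicator of [[::]] or the count
   for its own head. *)
elim: (e) => [|p e' IH] /=; first by rewrite big1.
move=> /andP[pr /IH->]; rewrite big_split /= addnACA -add1n; congr (_ + _)%N.
case: p pr => [_|s q sr] /=; first by rewrite big1.
rewrite add0n (bigD1_seq s)//= eqxx big1 ?addn0// => i /negPf.
by rewrite eq_sym => si; apply/eqP; rewrite eqb0; apply/eqP => -[] /eqP; rewrite si.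
Qed.

(** Endpoints range over all of [int * int], so that a step can always be subtracted; a negative
    abscissa gives no path. *)
Definition vpaths (z : int * int) : set (seq (int * int)) :=
  [set p | vconstrained p /\ endpoint p = z].
Definition vpathsR (z : int * int) : set (seq (int * int)) :=
  [set p | [/\ vconstrained p, starts_in_SC p & endpoint p = z]].
Definition nvpaths z : nat := #|` fset_set (vpaths z)|%fset.
Definition nvpathsR z : nat := #|` fset_set (vpathsR z)|%fset.

Lemma vpaths_neg z : z.1 < 0 -> vpaths z = set0.
Proof.
move=> z0; apply/seteqP; split=> // p [vp ep].
suff: False by []; have [] := vconstrained_bound vp; rewrite ep.
by move: (size p) z.2 z.1 z0 => n z2 z1; lia.
Qed.

Lemma vpathsR_sub z : vpathsR z `<=` vpaths z.
Proof. by move=> p []. Qed.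

Lemma vpaths_finite z : finite_set (vpaths z).
Proof.
case: z => -[n|n] m; first exact: pathsH_finite.
by rewrite vpaths_neg.
Qed.

Lemma vpathsR_finite z : finite_set (vpathsR z).
Proof. exact: sub_finite_set (@vpathsR_sub z) (vpaths_finite z). Qed.

Lemma nvpaths_neg z : z.1 < 0 -> nvpaths z = 0%N.
Proof. by move=> /vpaths_neg z0; rewrite /nvpaths z0 fset_set0. Qed.

(** Within [SCW], lying in [SC] is the same as not being vertical, so after a vertical step the
    adjacency test is [starts_in_SC p]. *)
Lemma vconstrained_cons s p :
  vconstrained (s :: p) =
  [&& s \in SCW, vconstrained p & (s \in SV) ==> starts_in_SC p].
Proof.
rewrite /vconstrained /=; case: (s \in SCW) => //=.
case: p => [|t p] /=; first by rewrite implybT.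
have [tS|_] := boolP (t \in SCW); last by [].
have -> : (t \in SC) = (t \notin SV).
  by move: tS; rewrite !inE => /or4P[/eqP->|/eqP->|/eqP->|/orP[]/eqP->].
rewrite negb_and implybE; case: (s \in SV); case: (t \in SV); case: (all _ _);
  by rewrite //= ?andbT ?andbF.
Qed.

Lemma vpaths_cons z s : s \in SC -> [set p | vpaths z (s :: p)] = vpaths (z - s).
Proof.
move=> sC; have [sS sV] : s \in SCW /\ s \notin SV.
  by move: sC; rewrite !inE => /or3P[]/eqP->.
apply/seteqP; split=> p; rewrite /vpaths /= vconstrained_cons sS (negPf sV) /= andbT endpoint_cons.
  by move=> [-> <-]; rewrite addrC addKr.
by move=> [-> ->]; rewrite addrC subrK.
Qed.

Lemma vpathsR_cons z s : s \in SC -> [set p | vpathsR z (s :: p)] = vpaths (z - s).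
Proof.
move=> sC; rewrite -vpaths_cons//; apply/seteqP; split=> p; rewrite /vpathsR /vpaths /= sC.
  by case.
by move=> [].
Qed.

Lemma vpaths_consV z s : s \in SV -> [set p | vpaths z (s :: p)] = vpathsR (z - s).
Proof.
move=> sV; have sS : s \in SCW by move: sV; rewrite !inE => /orP[]/eqP->.
apply/seteqP; split=> p; rewrite /vpaths /vpathsR /= vconstrained_cons sS sV /= endpoint_cons.
  by move=> [/andP[-> ->] <-]; rewrite addrC addKr.
by move=> [-> -> ->]; rewrite addrC subrK.
Qed.

Lemma vpathsR_consV z s : s \in SV -> [set p | vpathsR z (s :: p)] = set0.
Proof.
move=> sV; apply/seteqP; split=> // p; rewrite /vpathsR /=.
by move: sV; rewrite !inE => /orP[]/eqP-> [].
Qed.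

Lemma vpaths_head z s p : vpaths z (s :: p) -> s \in SCW.
Proof. by move=> [/andP[/= /andP[]]]. Qed.

Lemma nvpathsR_rec z :
  nvpathsR z = ((z == 0)%R + nvpaths (z - (1, 1))%R + nvpaths (z - (1, -1))%R
                + nvpaths (z - (2, 0))%R)%N.
Proof.
rewrite /nvpathsR (@card_fset_set_heads _ SCW)//; last 2 first.
- exact: vpathsR_finite.
- by move=> s p /vpathsR_sub/vpaths_head.
rewrite /SCW big_cat /= [X in (_ + (_ + X))%N]big_seq [X in (_ + (_ + X))%N]big1; last first.
  by move=> s sV; rewrite vpathsR_consV// fset_set0.
rewrite !big_cons big_nil !vpathsR_cons// !addn0 !addnA; congr (_ + _ + _ + _)%N.
congr nat_of_bool; apply/asboolP/eqP; rewrite /vpathsR /endpoint /= big_nil.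
  by case.
by move=> ->.
Qed.

(** The empty path and the first steps in [SC] together give [nvpathsR z]; after a vertical first
    step the tail must start in [SC]. *)
Lemma nvpaths_rec z :
  nvpaths z = (nvpathsR z + nvpathsR (z - (0, 2))%R + nvpathsR (z - (0, -2))%R)%N.
Proof.
rewrite {1}/nvpaths (@card_fset_set_heads _ SCW)//; last 2 first.
- exact: vpaths_finite.
- by move=> s p /vpaths_head.
rewrite nvpathsR_rec /SCW big_cat /= !big_cons !big_nil.
rewrite (@vpaths_cons z (1, 1))// (@vpaths_cons z (1, -1))// (@vpaths_cons z (2, 0))//.
rewrite (@vpaths_consV z (0, 2))// (@vpaths_consV z (0, -2))//.
rewrite !addn0 !addnA; congr (_ + _ + _ + _ + _ + _)%N.
congr nat_of_bool; apply/asboolP/eqP; rewrite /vpaths /endpoint /= big_nil.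
  by case.
by move=> ->.
Qed.

Lemma nvpaths_parity z : odd (absz (z.1 + z.2)) -> nvpaths z = 0%N.
Proof.
move=> oz; rewrite /nvpaths; suff -> : vpaths z = set0 by rewrite fset_set0.
apply/seteqP; split=> // p [/andP[pS _] ep]; move: oz; rewrite -{z}ep => /negP; apply.
elim: p pS => [_|s p IH /= /andP[sS /IH{}IH]]; first by rewrite /endpoint big_nil.
rewrite endpoint_cons; move: (endpoint p) IH => -[e1 e2] /= IH.
by move: sS; rewrite !inE => /or4P[/eqP->|/eqP->|/eqP->|/orP[]/eqP->] /=; lia.
Qed.

Lemma nvpathsR_parity z : odd (absz (z.1 + z.2)) -> nvpathsR z = 0%N.
Proof. by move=> /nvpaths_parity; rewrite nvpaths_rec; lia. Qed.

Lemma CHRE n m : CHR n m = nvpathsR (n%:Z, m).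
Proof. by []. Qed.

Lemma CHE n m : CH n m = nvpaths (n%:Z, m).
Proof. by []. Qed.

Lemma CH_rec n m : CH n m = (CHR n m + CHR n (m - 2)%R + CHR n (m + 2)%R)%N.
Proof.
rewrite CHE !CHRE nvpaths_rec; do ! congr (_ + _)%N; congr nvpathsR; congr (_, _);
  by rewrite ?subr0 ?opprK.
Qed.

(** The coefficient of x^n y^m in x^k G; the test guards against the truncated subtraction. *)
Definition CHs (k n : nat) (m : int) : nat := if (n < k)%N then 0 else CH (n - k) m.

Lemma nvpaths_shift k n m m' : nvpaths ((n%:Z, m) - (k%:Z, m')) = CHs k n (m - m').
Proof.
rewrite /CHs; case: ltnP => nk; first by rewrite nvpaths_neg//=; lia.
by rewrite CHE; congr nvpaths; congr (_, _); rewrite /=; lia.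
Qed.

Lemma CHR_rec n m :
  CHR n m = (((n == 0%N) && (m == 0)%R) + CHs 1 n (m - 1)%R + CHs 1 n (m + 1)%R + CHs 2 n m)%N.
Proof.
rewrite CHRE nvpathsR_rec !nvpaths_shift subr0 opprK.
by congr (_ + _ + _ + _)%N; congr nat_of_bool; rewrite -[0]/(0%:Z, 0) xpair_eqE.
Qed.

(** * Coefficient extraction and the bivariate generating functions *)

Lemma fcoefD (A : zmodType) (f g : fps A) n : fcoef (f + g) n = fcoef f n + fcoef g n.
Proof. by []. Qed.

Lemma fcoefN (A : zmodType) (f : fps A) n : fcoef (- f) n = - fcoef f n.
Proof. by []. Qed.

Lemma fcoefM (A : comNzRingType) (f g : fps A) n :
  fcoef (f * g) n = \sum_(i < n.+1) fcoef f i * fcoef g (n - i)%N.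
Proof. by []. Qed.

Lemma fcoef_constM (A : comNzRingType) (a : A) f n :
  fcoef (fconst a * f) n = a * fcoef f n.
Proof.
rewrite fcoefM big_ord_recl big1 /= ?subn0 ?addr0// => i _.
by rewrite mul0r.
Qed.

Lemma fcoef_XM (A : comNzRingType) (f : fps A) n :
  fcoef (fX * f) n = if n is n'.+1 then fcoef f n' else 0.
Proof.
rewrite fcoefM; case: n => [|n]; first by rewrite big_ord1 /= mul0r.
rewrite 2!big_ord_recl big1 /= ?mul0r ?mul1r ?add0r ?addr0 ?subn1//.
by move=> i _; rewrite mul0r.
Qed.

Lemma fcoef_XnM (A : comNzRingType) (f : fps A) k n :
  fcoef (fX ^+ k * f) n = if (n < k)%N then 0 else fcoef f (n - k).
Proof.
elim: k n => [|k IH] n; first by rewrite expr0 mul1r subn0.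
by rewrite exprS -mulrA fcoef_XM; case: n => [//|n]; rewrite IH ltnS subSS.
Qed.

Lemma lcoefD (R : zmodType) (f g : laurent R) m : (f + g) m = f m + g m.
Proof. by []. Qed.

Lemma flcoefD (R : comNzRingType) (f g : fps (laurent R)) n m :
  fcoef (f + g) n m = fcoef f n m + fcoef g n m.
Proof. by []. Qed.

Lemma lcoef_monoM (R : comNzRingType) (f : laurent R) k (a : R) m :
  (lmono k a * f) m = a * f (m - k).
Proof.
rewrite -[LHS]/(lconv _ _ _) (@lconvE _ _ _ _ [fset k]%fset).
  by rewrite big_seq_fset1 /= eqxx.
by move=> i /=; rewrite inE; case: (i == k) => //=; rewrite eqxx.
Qed.

Lemma lmonoM (R : comNzRingType) k l (a b : R) :
  lmono k a * lmono l b = lmono (k + l) (a * b).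
Proof.
apply: laurentP => m; rewrite lcoef_monoM /= subr_eq (addrC l).
by case: eqP => // _; rewrite mulr0.
Qed.

Lemma fconstM (A : comNzRingType) (a b : A) : fconst a * fconst b = fconst (a * b).
Proof.
by apply: fpsP => n; rewrite fcoef_constM /=; case: n => //= n; rewrite mulr0.
Qed.

Lemma lcoef_sum (R : zmodType) (I : Type) (r : seq I) (F : I -> laurent R) m :
  (\sum_(i <- r) F i) m = \sum_(i <- r) F i m.
Proof.
elim: r => [|i r IH]; first by rewrite !big_nil.
by rewrite !big_cons -IH.
Qed.

Lemma lcoef_gf_xy (c : nat -> int -> nat) n m :
  finite_set [set m | c n m != 0%N] -> fcoef (gf_xy c) n m = (c n m)%:Z.
Proof.
move=> cfin; rewrite /gf_xy /=.
rewrite (@fsbigTE _ _ _ _ (fset_set [set m | c n m != 0%N])); last first.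
  move=> i; have [-> _|ci /negP[]] := eqVneq (c n i) 0%N.
    by apply: laurentP => j /=; case: ifP.
  by rewrite in_fset_set// inE.
rewrite lcoef_sum; have [c0|c0] := eqVneq (c n m) 0%N.
  by rewrite c0 big1// => i _ /=; case: eqP => // <-; rewrite c0.
rewrite (big_fsetD1 m) ?in_fset_set ?inE//= eqxx big_seq big1 ?addr0// => i.
by rewrite !inE => /andP[/negPf]; rewrite eq_sym => ->.
Qed.

Lemma lcoef_gf_CH n m : fcoef (gf_xy CH) n m = (CH n m)%:Z.
Proof. by rewrite lcoef_gf_xy//; exact: CH_finite_support. Qed.

Lemma lcoef_gf_CHR n m : fcoef (gf_xy CHR) n m = (CHR n m)%:Z.
Proof. by rewrite lcoef_gf_xy//; exact: CHR_finite_support. Qed.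

(** The two path recurrences read coefficientwise, with [yV] as an explicit 1/y so that later
    algebra is division-free. *)
Lemma gf_xy_paths (x := fX : fps (laurent int)) (y := fconst (lmono 1 1))
    (yV := fconst (lmono (-1) 1)) :
  [/\ y * yV = 1,
      gf_xy CH = gf_xy CHR + y ^+ 2 * gf_xy CHR + yV ^+ 2 * gf_xy CHR
    & gf_xy CHR = 1 + x * (y * gf_xy CH) + x * (yV * gf_xy CH) + x ^+ 2 * gf_xy CH].
Proof.
have CHs0 k n m : (CHs k n m)%:Z = if (n < k)%N then 0 else fcoef (gf_xy CH) (n - k) m.
  by rewrite /CHs; case: ifP => // _; rewrite lcoef_gf_CH.
split; first by rewrite fconstM lmonoM.
  apply: fpsP => n; apply: laurentP => m.
  rewrite !expr2 !fconstM !lmonoM !fcoefD !lcoefD !fcoef_constM !lcoef_monoM.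
  by rewrite lcoef_gf_CH !lcoef_gf_CHR CH_rec !PoszD !mulr1 !mul1r.
apply: fpsP => n; apply: laurentP => m.
rewrite lcoef_gf_CHR CHR_rec; move: (gf_xy CH) CHs0 => G CHs0.
rewrite !PoszD !CHs0 -[in x * (y * _)](expr1 x) -[in x * (yV * _)](expr1 x).
rewrite 3!flcoefD; congr (_ + _ + _ + _).
- by case: n => [|n] //=; case: eqP.
- by rewrite fcoef_XnM; case: ifP => // _; rewrite fcoef_constM lcoef_monoM mul1r.
- by rewrite fcoef_XnM; case: ifP => // _; rewrite fcoef_constM lcoef_monoM mul1r opprK.
- by rewrite fcoef_XnM; case: ifP.
Qed.

Lemma gf_xy_rational (x := fX : fps (laurent int)) (y := fconst (lmono 1 1)) :
  gf_xy CHR = y ^+ 3 / H x y /\ gf_xy CH = y * (1 + y ^+ 2 + y ^+ 4) / H x y.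
Proof.
have [] := gf_xy_paths; rewrite -/x -/y; move: (fconst _) => yV yyV HE RE.
move: (gf_xy CH) (gf_xy CHR) HE RE => G R GE RE.
have y3 : y ^+ 3 * yV ^+ 3 = 1 by rewrite -exprMn yyV expr1n.
have y3G : y ^+ 2 * G = (1 + y ^+ 2 + y ^+ 4) * R.
  have -> : y ^+ 2 * G = y ^+ 2 * (1 + y ^+ 2) * R + (y * yV) ^+ 2 * R by rewrite GE; ring.
  by rewrite yyV; ring.
have RH : R * H x y = y ^+ 3.
  have yR : y ^+ 3 * R = y ^+ 3 + x * (y ^+ 2 + y * yV + x * y) * (y ^+ 2 * G).
    by rewrite {1}RE; ring.
  apply/eqP; rewrite -subr_eq0; apply/eqP; rewrite /H.
  transitivity (y ^+ 3 * R - (y ^+ 3 + x * (y ^+ 2 + 1 + x * y) * ((1 + y ^+ 2 + y ^+ 4) * R))).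
    by ring.
  by rewrite yR yyV -y3G subrr.
(* H divides the unit y^3, hence is a unit, which gives the quotients their meaning. *)
have Hu : H x y \is a GRing.unit.
  by apply/unitrPr; exists (yV ^+ 3 * R); rewrite mulrC -mulrA RH mulrC.
have RE' : R = y ^+ 3 / H x y by rewrite -RH mulrK.
split=> //; apply: (mulIr Hu); rewrite mulrVK//.
(* It is y^2 G that [y3G] expresses through R, hence the factor (y/y)^2. *)
have -> : G = (y * yV) ^+ 2 * G by rewrite yyV expr1n mul1r.
have -> : (y * yV) ^+ 2 * G = yV ^+ 2 * (y ^+ 2 * G) by ring.
rewrite y3G.
have -> : yV ^+ 2 * ((1 + y ^+ 2 + y ^+ 4) * R) * H x y =
  yV ^+ 2 * (1 + y ^+ 2 + y ^+ 4) * (R * H x y) by ring.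
rewrite RH -[RHS]mul1r -(expr1n _ 2) -yyV; ring.
Qed.

(** * Reduction modulo the variable, and Hensel's lemma *)

Definition fps0 (A : Type) (f : fps A) : A := fcoef f 0.

Section FpsConstantTerm.
Variable A : comNzRingType.

Fact fps0_is_zmod_morphism : zmod_morphism (@fps0 A).
Proof. by []. Qed.

Fact fps0_is_monoid_morphism : monoid_morphism (@fps0 A).
Proof. by split=> // f g; rewrite /fps0 fcoefM big_ord1. Qed.

HB.instance Definition _ := GRing.isZmodMorphism.Build (fps A) A (@fps0 A)
  fps0_is_zmod_morphism.
HB.instance Definition _ := GRing.isMonoidMorphism.Build (fps A) A (@fps0 A)
  fps0_is_monoid_morphism.

Lemma fps0X : fps0 (fX : fps A) = 0.
Proof. by []. Qed.

Lemma fps0_horner (p : {poly fps A}) u : fps0 p.[u] = (map_poly (@fps0 A) p).[fps0 u].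
Proof. by rewrite horner_map. Qed.

Lemma fps_factorX k (f : fps A) :
  (forall i, (i < k)%N -> fcoef f i = 0) -> exists g, f = fX ^+ k * g.
Proof.
move=> f0; exists (FPS (fun n => fcoef f (n + k))); apply: fpsP => n.
by rewrite fcoef_XnM; case: ltnP => [/f0//|kn] /=; rewrite subnK.
Qed.

Lemma fps0_factorX (f : fps A) : fps0 f = 0 -> exists g, f = fX * g.
Proof. by move=> f0; rewrite -[fX]expr1; apply: fps_factorX => -[]. Qed.

(** Coefficient n of a multiple of [fX ^+ n.+1] vanishes: equalities can be proved by ever finer
    approximation. *)
Lemma fps_adic_eq0 (f : fps A) : (forall k, exists g, f = fX ^+ k * g) -> f = 0.
Proof.
by move=> fk; apply: fpsP => n; have [g ->] := fk n.+1; rewrite fcoef_XnM ltnSn.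
Qed.

Lemma poly_factorX (p : {poly fps A}) :
  map_poly (@fps0 A) p = 0 -> exists q, p = fX%:P * q.
Proof.
move=> p0; exists (\poly_(i < size p) FPS (fun n => fcoef p`_i n.+1)).
apply/polyP => i; rewrite coefCM coef_poly; case: ltnP => ip; last first.
  by rewrite mulr0 nth_default.
apply: fpsP => n; rewrite fcoef_XM; case: n => //.
by move/polyP/(_ i): p0; rewrite coef_map coef0.
Qed.

End FpsConstantTerm.

Section Hensel.
Variables (K : fieldType) (P : {poly fps K}) (a : K).
Let P0 := map_poly (@fps0 K) P.
Hypotheses (P0a : P0.[a] = 0) (dP0a : P0^`().[a] != 0).

(** Newton's iteration with the derivative frozen at its value at [a]: each step gains one power of
    [fX]. *)
Let c : fps K := fconst (P0^`().[a])^-1.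
Let newton z := z - c * P.[z].

Let newton0 z : fps0 z = a -> fps0 (newton z) = a.
Proof.
by move=> za; rewrite /newton rmorphB rmorphM /= fps0_horner -/P0 za P0a mulr0 subr0.
Qed.

(** With Q the difference quotient of P at z', the left side is (1 - c Q(z))(z - z'), and Q(z)
    reduces to P0'(a), the inverse of c. *)
Let newton_contract z z' : fps0 z = a -> fps0 z' = a ->
  exists w, newton z - newton z' = fX * w * (z - z').
Proof.
move=> za z'a.
have [Q PQ] : exists Q, P - P.[z']%:P = Q * ('X - z'%:P).
  by apply/factor_theorem; rewrite rootE !hornerE subrr.
have Qa : (map_poly (@fps0 K) Q).[a] = P0^`().[a].
  have /(congr1 (fun p => p^`().[a])) := congr1 (map_poly (@fps0 K)) PQ.
  rewrite rmorphB rmorphM rmorphB /= !map_polyC map_polyX /= z'a -/P0 => /=.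
  by rewrite !derivE !hornerE subrr mulr0 add0r subr0 => ->.
have [w wE] : exists w, 1 - c * Q.[z] = fX * w.
  apply: fps0_factorX; rewrite rmorphB rmorph1 rmorphM /= fps0_horner za Qa.
  by rewrite mulVf ?subrr.
exists w; rewrite -wE /newton.
have := congr1 (fun p => p.[z]) PQ; rewrite !hornerE => PE.
have -> : P.[z] = P.[z'] + Q.[z] * (z - z') by rewrite -PE addrC subrK.
by ring.
Qed.

Let approx n := iter n newton (fconst a).

Let approx0 n : fps0 (approx n) = a.
Proof. by elim: n => //= n; exact: newton0. Qed.

Let approx_step n : exists w, approx n.+1 - approx n = fX ^+ n.+1 * w.
Proof.
elim: n => [|n [w wE]].
  rewrite expr1; apply: fps0_factorX; apply/eqP; rewrite rmorphB subr_eq0.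
  by apply/eqP; rewrite -[LHS]/(fps0 (approx 1)) approx0.
have [v vE] := newton_contract (approx0 n.+1) (approx0 n).
exists (v * w); rewrite [approx n.+2 - _]vE wE [in RHS]exprS; ring.
Qed.

Let approx_stable n k : (k <= n)%N -> fcoef (approx n) k = fcoef (approx k) k.
Proof.
elim: n => [|n IH]; first by rewrite leqn0 => /eqP->.
rewrite leq_eqVlt => /orP[/eqP->//|]; rewrite ltnS => kn; rewrite -IH//.
have [w /(congr1 (fun f => fcoef f k))] := approx_step n.
rewrite fcoef_XnM ltnS kn => /eqP; rewrite fcoefD fcoefN subr_eq0 => /eqP.
exact.
Qed.

Lemma hensel : exists2 z : fps K, fps0 z = a & P.[z] = 0.
Proof.
(* The limit of the iteration: coefficient n no longer changes from [approx n] on. *)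
pose z : fps K := FPS (fun n => fcoef (approx n) n).
have za : fps0 z = a by [].
have zn n : exists w, z - approx n = fX ^+ n.+1 * w.
  apply: fps_factorX => i; rewrite ltnS => ilen.
  by rewrite fcoefD fcoefN approx_stable//= subrr.
exists z => //.
suff /eqP : c * P.[z] = 0.
  rewrite mulf_eq0 => /orP[/eqP/(congr1 (@fps0 K))|/eqP//].
  by move=> /eqP; rewrite rmorph0 [fps0 c]/= invr_eq0 (negPf dP0a).
apply: fps_adic_eq0 => n.
have [w wE] := zn n; have [v vE] := newton_contract za (approx0 n).
have [u uE] := zn n.+1.
(* The terms [fX * w] cancel, leaving [fX ^+ 2 * (u - v * w)]. *)
exists (fX * w - fX * v * fX * w + (fX ^+ 2 * u - fX * w)).
have -> : c * P.[z] = (z - approx n.+1) - (newton z - newton (approx n)).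
  by rewrite /newton /=; rewrite -/(newton (approx n)) /newton; ring.
by rewrite uE vE wE !exprS; ring.
Qed.

End Hensel.

(** * Lagrange interpolation and residues at the small roots *)

Lemma uniq_roots_factor (A : idomainType) (p : {poly A}) (rs : seq A) :
  uniq rs -> all (root p) rs -> exists q, p = \prod_(s <- rs) ('X - s%:P) * q.
Proof.
elim: rs p => [|s rs IH] p; first by exists p; rewrite big_nil mul1r.
move=> /= /andP[srs urs] /andP[/factor_theorem[q ->] qrs].
have [|q' ->] := IH q urs; last by exists q'; rewrite big_cons; ring.
apply/allP => s' s'rs; move/allP/(_ s' s'rs): qrs; rewrite rootM root_XsubC.
by case/orP => // /eqP s's; move: srs; rewrite -s's s'rs.
Qed.

Section CoefficientFunctional.
Variables (A : comNzRingType) (a : int -> A).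

(* The coefficient of y^m in p(y) * sum_k a(k) y^k. *)
Definition pcoef (m : int) (p : {poly A}) : A :=
  \sum_(j < size p) p`_j * a (m - j%:Z).

Lemma pcoefE N m (p : {poly A}) : (size p <= N)%N -> pcoef m p = \sum_(j < N) p`_j * a (m - j%:Z).
Proof.
move=> pN; rewrite /pcoef (big_ord_widen _ (fun j : nat => p`_j * a (m - j%:Z)) pN).
rewrite big_mkcond; apply: eq_bigr => j _; case: ltnP => // pj.
by rewrite nth_default// mul0r.
Qed.

Lemma pcoefD m p q : pcoef m (p + q) = pcoef m p + pcoef m q.
Proof.
pose N := maxn (size p) (size q).
rewrite !(@pcoefE N) ?leq_maxl ?leq_maxr ?size_polyD//.
by rewrite -big_split; apply: eq_bigr => j _; rewrite coefD mulrDl.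
Qed.

Lemma pcoefCM m c p : pcoef m (c%:P * p) = c * pcoef m p.
Proof.
rewrite [LHS](@pcoefE (size p)); last by rewrite mul_polyC size_scale_leq.
by rewrite /pcoef mulr_sumr; apply: eq_bigr => j _; rewrite coefCM mulrA.
Qed.

Lemma pcoefB m p q : pcoef m (p - q) = pcoef m p - pcoef m q.
Proof. by rewrite -mulN1r -polyCN pcoefD pcoefCM mulN1r. Qed.

Lemma pcoefXM m p : pcoef m ('X * p) = pcoef (m - 1) p.
Proof.
rewrite (@pcoefE (size p).+1); last first.
  by have [->|/size_mulX] := eqVneq p 0; rewrite ?mulr0 ?size_poly0// mulrC => ->.
rewrite big_ord_recl coefXM mul0r add0r; apply: eq_bigr => j _.
by rewrite coefXM /=; congr (_ * a _); rewrite /bump /=; lia.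
Qed.

Lemma pcoef1 m : pcoef m 1 = a m.
Proof. by rewrite (@pcoefE 1) ?size_poly1// big_ord1 coef1 mul1r subr0. Qed.

Lemma pcoefXn m k : pcoef m 'X^k = a (m - k%:Z).
Proof.
elim: k m => [|k IH] m; first by rewrite expr0 pcoef1 subr0.
by rewrite exprS pcoefXM IH; congr a; lia.
Qed.

Lemma pcoef0 m : pcoef m 0 = 0.
Proof. by rewrite /pcoef size_poly0 big_ord0. Qed.

(** The hypothesis makes [a] the coefficient sequence of 1/h, so h p times that sequence is p
    again. *)
Lemma pcoef_inverse (h : {poly A}) : (forall m, pcoef m h = (m == 0)%:R) ->
  forall m p, pcoef m (h * p) = if m is Posz k then p`_k else 0.
Proof.
move=> hE m p; elim/poly_ind: p m => [|p c IH] m.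
  by rewrite mulr0 pcoef0; case: m => // k; rewrite coef0.
have -> : h * (p * 'X + c%:P) = 'X * (h * p) + c%:P * h by ring.
rewrite pcoefD pcoefXM pcoefCM IH hE; case: m => [[|k]|k].
- by rewrite sub0r /= mulr1 add0r coefD coefMX coefC eqxx add0r.
- have -> : Posz k.+1 - 1 = Posz k by lia.
  by rewrite mulr0 addr0 coefD coefMX coefC addr0.
- have -> : Negz k - 1 = Negz k.+1 by lia.
  by rewrite mulr0 addr0.
Qed.

End CoefficientFunctional.

(** Division of the interpolation identity by the Vandermonde product, stated over a generic field
    so that [field] sees plain variables. *)
Lemma lagrange_quotient (F : fieldType) (s1 s2 s3 n1 n2 n3 u1 u2 u3 l : F) :
  s1 - s2 != 0 -> s1 - s3 != 0 -> s2 - s3 != 0 -> u1 != 0 -> u2 != 0 -> u3 != 0 ->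
  (s1 - s2) * (s1 - s3) * (s2 - s3) * l =
    n1 * (s2 - s3) / u1 - n2 * (s1 - s3) / u2 + n3 * (s1 - s2) / u3 ->
  l = n1 / ((s1 - s2) * (s1 - s3) * u1) + n2 / (- ((s1 - s2) * (s2 - s3)) * u2)
      + n3 / ((s1 - s3) * (s2 - s3) * u3).
Proof.
move=> d12 d13 d23 u1n u2n u3n E.
have nz : (s1 - s2) * (s1 - s3) * (s2 - s3) != 0 by rewrite !mulf_neq0.
apply: (mulfI nz); rewrite E; field.
by rewrite oppr_eq0 mulf_neq0 ?u1n ?u2n ?u3n ?d12 ?d13 ?d23.
Qed.

Section Residues.
Variables (K : fieldType) (a : int -> fps K) (h U V : {poly fps K}) (s1 s2 s3 : fps K).
Hypothesis ah : forall m, pcoef a m h = (m == 0)%:R.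
Hypothesis s_small : {in [:: s1; s2; s3], forall s, fps0 s = 0}.
Hypothesis s_uniq : uniq [:: s1; s2; s3].
Let Pi := ('X - s1%:P) * ('X - s2%:P) * ('X - s3%:P).
Hypothesis hU : h = Pi * U.
Hypothesis UV : U = 1 + fX%:P * V.

Let res := pcoef a (-1).

(* As U = 1 mod t, every p is congruent to a multiple of U modulo any power of
   t, and [res] vanishes on the multiples of h. *)
Let res_Pi p : res (Pi * p) = 0.
Proof.
apply: fps_adic_eq0 => k; elim: k p => [|k IH] p.
  by exists (res (Pi * p)); rewrite expr0 mul1r.
have [g gE] := IH (V * p); exists (- g).
have -> : Pi * p = h * p - fX%:P * (Pi * (V * p)) by rewrite hU UV; ring.
rewrite /res pcoefB (pcoef_inverse ah) pcoefCM -/res gE exprS.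
by rewrite [X in X - _]/=; ring.
Qed.

(** Q/h is 1/(y - s); since s is small, it is expanded in negative powers of y, starting with
    y^-1. *)
Let res_cofactor s Q : fps0 s = 0 -> h = ('X - s%:P) * Q -> res Q = 1.
Proof.
move=> s0 hQ; pose e m := pcoef a m Q.
have eE m : e (m - 1) - s * e m = (m == 0)%:R.
  by rewrite -ah hQ mulrBl pcoefB pcoefXM pcoefCM.
(* Telescoping gives e(0) = s^k e(k) for every k, and s is divisible by [fX]. *)
have e0 : e 0 = 0.
  have [s' sE] := fps0_factorX s0.
  apply: fps_adic_eq0 => k; exists (s' ^+ k * e k%:Z).
  rewrite mulrA -exprMn -sE; elim: k => [|k ->]; first by rewrite expr0 mul1r.
  have /eqP := eE k.+1; have -> : Posz k.+1 - 1 = Posz k by lia.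
  by rewrite subr_eq0 => /eqP->; rewrite exprSr mulrA.
by have := eE 0; rewrite e0 mulr0 subr0 sub0r.
Qed.

(** The cofactor of y - s in h is Q U, and freezing U at s changes Q U by a multiple of Pi, which
    has no residue. *)
Let res_factor s Q : fps0 s = 0 -> Pi = ('X - s%:P) * Q -> U.[s] * res Q = 1.
Proof.
move=> s0 PiQ; have <- : res (Q * U) = 1.
  by apply: (res_cofactor s0); rewrite hU PiQ mulrA.
have [W WE] : exists W, U - U.[s]%:P = W * ('X - s%:P).
  by apply/factor_theorem; rewrite rootE !hornerE subrr.
have -> : Q * U = U.[s]%:P * Q + Pi * W.
  have -> : U = U.[s]%:P + W * ('X - s%:P) by rewrite -WE addrC subrK.
  by rewrite !hornerE subrr mulr0 addr0 PiQ; ring.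
by rewrite /res pcoefD pcoefCM -/res res_Pi addr0.
Qed.

Let deriv_root s Q : Pi = ('X - s%:P) * Q -> h^`().[s] = Q.[s] * U.[s].
Proof.
by move=> PiQ; rewrite hU PiQ !derivE !hornerE subrr; ring.
Qed.

Lemma residue_formula (N : {poly fps K}) :
  (pcoef a (-1) N)%:F =
  N.[s1]%:F / h^`().[s1]%:F + N.[s2]%:F / h^`().[s2]%:F + N.[s3]%:F / h^`().[s3]%:F.
Proof.
have [s10 s20 s30] : [/\ fps0 s1 = 0, fps0 s2 = 0 & fps0 s3 = 0].
  by split; apply: s_small; rewrite !inE eqxx ?orbT.
have [d12 d13 d23] : [/\ s1 - s2 != 0, s1 - s3 != 0 & s2 - s3 != 0].
  by move: s_uniq; rewrite !subr_eq0 /= !inE negb_or andbT => /andP[/andP[]].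
pose Q1 := ('X - s2%:P) * ('X - s3%:P); pose Q2 := ('X - s1%:P) * ('X - s3%:P).
pose Q3 := ('X - s1%:P) * ('X - s2%:P).
have PiQ1 : Pi = ('X - s1%:P) * Q1 by rewrite /Pi /Q1; ring.
have PiQ2 : Pi = ('X - s2%:P) * Q2 by rewrite /Pi /Q2; ring.
have PiQ3 : Pi = ('X - s3%:P) * Q3 by rewrite /Pi /Q3; ring.
have r1 := res_factor s10 PiQ1; have r2 := res_factor s20 PiQ2.
have r3 := res_factor s30 PiQ3.
rewrite (deriv_root PiQ1) (deriv_root PiQ2) (deriv_root PiQ3) -/res.
(* Multiplying by the Vandermonde product keeps the interpolation over [fps K]. *)
pose d := (s1 - s2) * (s1 - s3) * (s2 - s3).
have lagrange : d * res N = N.[s1] * (s2 - s3) * res Q1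
    - N.[s2] * (s1 - s3) * res Q2 + N.[s3] * (s1 - s2) * res Q3.
  (* d times N minus its interpolant: it vanishes at all three roots, so it is a multiple of Pi. *)
  pose p := d%:P * N - (N.[s1] * (s2 - s3))%:P * Q1
    + (N.[s2] * (s1 - s3))%:P * Q2 - (N.[s3] * (s1 - s2))%:P * Q3.
  have [|q pq] := uniq_roots_factor s_uniq (p := p).
    pose hE := (hornerD, hornerN, hornerM, hornerC, hornerX).
    have e1 : p.[s1] = 0 by rewrite /p /Q1 /Q2 /Q3 /d !hE; ring.
    have e2 : p.[s2] = 0 by rewrite /p /Q1 /Q2 /Q3 /d !hE; ring.
    have e3 : p.[s3] = 0 by rewrite /p /Q1 /Q2 /Q3 /d !hE; ring.
    by rewrite /= /root e1 e2 e3 eqxx.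
  have p0 : res p = 0.
    rewrite pq -[RHS](res_Pi q); congr (res (_ * q)).
    by rewrite !big_cons big_nil mulr1 mulrA.
  move: p0; rewrite /p /res !(pcoefB, pcoefD, pcoefCM) => /eqP.
  by rewrite subr_eq0 => /eqP <-; ring.
have u1 : U.[s1] != 0 by apply/eqP => U0; move/eqP: r1; rewrite U0 mul0r eq_sym oner_eq0.
have u2 : U.[s2] != 0 by apply/eqP => U0; move/eqP: r2; rewrite U0 mul0r eq_sym oner_eq0.
have u3 : U.[s3] != 0 by apply/eqP => U0; move/eqP: r3; rewrite U0 mul0r eq_sym oner_eq0.
have -> : Q1.[s1] = (s1 - s2) * (s1 - s3) by rewrite !hornerE.
have -> : Q2.[s2] = - ((s1 - s2) * (s2 - s3)) by rewrite !hornerE; ring.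
have -> : Q3.[s3] = (s1 - s3) * (s2 - s3) by rewrite !hornerE; ring.
have inv u r : u != 0 -> u * r = 1 -> r%:F = (u%:F)^-1 :> fls K.
  move=> u0 ur; apply: (@mulfI _ u%:F); first by rewrite tofrac_eq0.
  by rewrite -tofracM ur tofrac1 mulfV// tofrac_eq0.
have nz (u : fps K) : u != 0 -> u%:F != 0 :> fls K by rewrite tofrac_eq0.
have := congr1 (@FracField.tofrac _) lagrange; rewrite /d.
move: (nz _ d12) (nz _ d13) (nz _ d23) (nz _ u1) (nz _ u2) (nz _ u3).
rewrite !(tofracD, tofracN, tofracM) (inv _ _ u1 r1) (inv _ _ u2 r2) (inv _ _ u3 r3).
exact: lagrange_quotient.
Qed.

End Residues.

(** * The finite roots of H at x = t^3 *)

Lemma rmorphH (A B : comNzRingType) (f : {rmorphism A -> B}) x y :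
  f (H x y) = H (f x) (f y).
Proof. by rewrite /H !(rmorphB, rmorphD, rmorphM, rmorphXn, rmorph1). Qed.

Lemma H0 (A : comNzRingType) (y : A) : H 0 y = y ^+ 3.
Proof. by rewrite /H !mul0r subr0. Qed.

Section HPoly.
Variable K : fieldType.

Lemma fps0X3 : fps0 (fX ^+ 3 : fps K) = 0.
Proof. by rewrite rmorphXn expr0n. Qed.

Definition Hpoly : {poly fps K} := H (fX ^+ 3)%:P 'X.

Lemma horner_Hpoly u : Hpoly.[u] = H (fX ^+ 3) u.
Proof.
by rewrite /Hpoly /H !(hornerD, hornerN, hornerM, hornerC, hornerX, horner_exp).
Qed.

Lemma map_Hpoly : map_poly (@fps0 K) Hpoly = 'X^3.
Proof.
transitivity (H (map_poly (@fps0 K) (fX ^+ 3)%:P) (map_poly (@fps0 K) 'X)).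
  exact: rmorphH.
by rewrite map_polyC map_polyX [X in X%:P]fps0X3 H0.
Qed.

(** Modulo t, H is y^3: its roots reduce to 0, and cancelling y^3 shows that the remaining factor
    reduces to 1. *)
Lemma Hpoly_factor (u1 u2 u3 : fps K) : uniq [:: u1; u2; u3] ->
  {in [:: u1; u2; u3], forall u, H (fX ^+ 3) u = 0} ->
  {in [:: u1; u2; u3], forall u, fps0 u = 0} /\
  exists V, Hpoly = ('X - u1%:P) * ('X - u2%:P) * ('X - u3%:P) * (1 + fX%:P * V).
Proof.
move=> uu Hu.
have u0 : {in [:: u1; u2; u3], forall u, fps0 u = 0}.
  move=> u /Hu /(congr1 (@fps0 K)); rewrite rmorphH rmorph0 [X in H X]fps0X3 H0.
  by move/eqP; rewrite expf_eq0 => /eqP.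
split=> //; have [|U hU] := uniq_roots_factor uu (p := Hpoly).
  by apply/allP => u /Hu; rewrite -horner_Hpoly => /eqP.
have [V VE] : exists V, U - 1 = fX%:P * V.
  apply: poly_factorX; rewrite rmorphB rmorph1; apply/eqP; rewrite subr_eq0.
  have /eqP := map_Hpoly; rewrite hU !big_cons big_nil !rmorphM !rmorphB rmorph1 /=.
  rewrite !map_polyC map_polyX /= !u0 ?inE ?eqxx ?orbT// subr0 mulr1 !mulrA.
  have -> : 'X * 'X * 'X = 'X^3 :> {poly K} by ring.
  rewrite -[X in _ == X]mulr1 => /eqP/mulfI -> //.
  by rewrite expf_neq0 ?polyX_eq0.
by exists V; rewrite hU !big_cons big_nil -VE; ring.
Qed.

(** Recording the coefficient of t serves to tell apart the roots grown from different [a]. *)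
Lemma small_root (a : K) : a ^+ 3 = 1 -> 3 != 0 :> K ->
  exists u : fps K, [/\ fps0 u = 0, fcoef u 1 = a & H (fX ^+ 3) u = 0].
Proof.
move=> a3 K3.
pose t : {poly fps K} := fX%:P.
(* H(t^3, t z) = t^3 P(z) *)
pose P : {poly fps K} := 'X^3 -
  (1 + t ^+ 4 * 'X + t ^+ 2 * 'X^2) * (1 + t ^+ 2 * 'X^2 + t ^+ 4 * 'X^4).
have t0 : map_poly (@fps0 K) t = 0 by rewrite map_polyC [X in X%:P]fps0X.
have P0 : map_poly (@fps0 K) P = 'X^3 - 1.
  rewrite /P !(rmorphB, rmorphD, rmorphM, rmorphXn, rmorph1) /= t0 map_polyX.
  by ring.
have [||z za zP] := @hensel K P a; rewrite ?P0.
- by rewrite !hornerE a3 subrr.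
- have -> : ('X^3 - 1)^`().[a] = 3 * a ^+ 2.
    by rewrite !derivE subr0 hornerMn hornerXn mulr_natl.
  rewrite mulf_neq0// expf_neq0//.
  by apply/eqP => a0; move/eqP: a3; rewrite a0 expr0n eq_sym oner_eq0.
exists (fX * z); split.
- by rewrite rmorphM [X in X * _]fps0X mul0r.
- by rewrite fcoef_XM.
- suff -> : H (fX ^+ 3) (fX * z) = fX ^+ 3 * P.[z] by rewrite zP mulr0.
  rewrite /P /t !(hornerD, hornerN, hornerM, hornerC, hornerX, horner_exp) /H.
  by ring.
Qed.

End HPoly.

Lemma cube_roots_of_unity (C : numClosedFieldType) :
  exists a b c : C, uniq [:: a; b; c] /\ [/\ a ^+ 3 = 1, b ^+ 3 = 1 & c ^+ 3 = 1].
Proof.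
(* A root of X^2 + X + 1; the other one is -1 - w. *)
pose w : C := (sqrtC (-3) - 1) / 2.
have C2 : (2 : C) != 0 by rewrite pnatr_eq0.
have C3 : (3 : C) != 0 by rewrite pnatr_eq0.
have w0 : w ^+ 2 + w + 1 = 0.
  have : sqrtC (-3) ^+ 2 = -3 :> C by rewrite sqrtCK.
  have w2 : 2 * w = sqrtC (-3) - 1 by rewrite /w mulrC divfK.
  move: (sqrtC (-3)) w2 => q w2 q2; apply: (mulfI C2); apply: (mulfI C2).
  transitivity ((2 * w) ^+ 2 + 2 * (2 * w) + 4); first by ring.
  transitivity (q ^+ 2 + 3); first by rewrite w2; ring.
  by rewrite q2; ring.
exists 1, w, (-1 - w); split; last first.
  split; first by rewrite expr1n.
    by apply/eqP; rewrite -subr_eq0; apply/eqP; transitivity ((w - 1) * (w ^+ 2 + w + 1));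
      [ring | rewrite w0 mulr0].
  by apply/eqP; rewrite -subr_eq0; apply/eqP; transitivity (- (w + 2) * (w ^+ 2 + w + 1));
    [ring | rewrite w0 mulr0].
(* Any coincidence among the three would force 3 = 0. *)
rewrite /= !inE negb_or andbT -andbA; apply/and3P; split; apply/eqP => E; case/eqP: C3.
- by rewrite -[RHS]w0 -E; ring.
- have wE : w = -2.
    by transitivity (-1 - (-1 - w)); [ring | rewrite -E; ring].
  by rewrite -[RHS]w0 wE; ring.
- have wE : 2 * w + 1 = 0 by transitivity (w - (-1 - w)); [ring | rewrite -E subrr].
  rewrite (_ : 3 = 4 * (w ^+ 2 + w + 1) - (2 * w + 1) ^+ 2); last by ring.
  by rewrite w0 wE; ring.
Qed.

Section FiniteRoots.
Variable C : numClosedFieldType.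

Lemma H_tofrac (u : fps C) : H xt u%:F = (H (fX ^+ 3) u)%:F.
Proof. by rewrite rmorphH. Qed.

Lemma H_tofrac_eq0 (u : fps C) : H xt u%:F = 0 <-> H (fX ^+ 3) u = 0.
Proof.
rewrite H_tofrac; split=> [/eqP|->]; last by rewrite tofrac0.
by rewrite tofrac_eq0 => /eqP.
Qed.

Lemma finite_roots_exist : exists s1 s2 s3 : fls C,
  the_finite_roots s1 s2 s3 /\ [/\ vanishes_at0 s1, vanishes_at0 s2 & vanishes_at0 s3].
Proof.
have C3 : (3 : C) != 0 by rewrite pnatr_eq0.
have [a [b [c [abc [a3 b3 c3]]]]] := cube_roots_of_unity C.
have [u1 [u10 u1a H1]] := small_root a3 C3.
have [u2 [u20 u2b H2]] := small_root b3 C3.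
have [u3 [u30 u3c H3]] := small_root c3 C3.
have uu : uniq [:: u1; u2; u3].
  apply: (@map_uniq _ _ (fun u : fps C => fcoef u 1)).
  by rewrite /= u1a u2b u3c.
have Hu : {in [:: u1; u2; u3], forall u, H (fX ^+ 3) u = 0}.
  by move=> u; rewrite !inE => /or3P[]/eqP->.
have [_ [V hV]] := Hpoly_factor uu Hu.
exists u1%:F, u2%:F, u3%:F; split; last by split; [exists u1|exists u2|exists u3].
split; first by move: uu; rewrite /= !inE !tofrac_eq.
move=> y; split=> [[Hy [u yu]]|].
  move: Hy; rewrite {}yu H_tofrac_eq0 -horner_Hpoly hV !inE !tofrac_eq => /eqP.
  rewrite !(hornerM, hornerD, hornerN, hornerX, hornerC) !mulf_eq0 !subr_eq0 -orbA.
  (* The cofactor 1 + t V has constant term 1 at every power series, so it contributes no root. *)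
  rewrite orbA [X in _ || X](_ : _ = false) ?orbF -?orbA//; apply/negbTE/eqP.
  move=> /(congr1 (@fps0 C)); rewrite rmorphD rmorphM rmorph1.
  rewrite [X in _ + X * _]fps0X mul0r addr0 rmorph0.
  by move/eqP; rewrite oner_eq0.
by rewrite !inE => /or3P[]/eqP->; (split; [exact/H_tofrac_eq0 | by eexists]).
Qed.

End FiniteRoots.

(** * The univariate generating functions as even and odd parts of D *)

Lemma fps_subX3D (A : zmodType) (f g : fps A) :
  fps_subX3 (f + g) = fps_subX3 f + fps_subX3 g.
Proof. by apply: fpsP => n /=; case: ifP; rewrite ?addr0. Qed.

Lemma fps_subX3_1 (A : comNzRingType) : fps_subX3 (1 : fps A) = 1.
Proof.
apply: fpsP => n; rewrite -[LHS]/(if (3 %| n)%N then fcoef 1 (n %/ 3) else 0).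
by case: n => [//|n]; case: ifP => // /dvdnP[[//|k] ->]; rewrite mulnK.
Qed.

Lemma fps_subX3_XM (A : comNzRingType) (f : fps A) :
  fps_subX3 (fX * f) = fX ^+ 3 * fps_subX3 f.
Proof.
apply: fpsP => n; rewrite fcoef_XnM.
rewrite -[LHS]/(if (3 %| n)%N then fcoef (fX * f) (n %/ 3) else 0) fcoef_XM.
case: ltnP => n3; first by case: n n3 => [|[|[|n]]].
have -> : (n %/ 3 = ((n - 3) %/ 3).+1)%N by lia.
by have -> : (3 %| n)%N = (3 %| n - 3)%N by lia.
Qed.

Section ConstantTerms.
Variable C : numClosedFieldType.

Let r m : fps C := gf_x C (CHR^~ m).
Let g m : fps C := gf_x C (CH^~ m).

Lemma gf_x_CH m : g m = r m + r (m - 2) + r (m + 2).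
Proof. by apply: fpsP => n; rewrite !fcoefD /= CH_rec !natrD. Qed.

Lemma gf_x_CHR m :
  r m = (if m == 0 then 1 else 0) + fX * g (m - 1) + fX * g (m + 1) + fX ^+ 2 * g m.
Proof.
have gs k n m' : (CHs k n m')%:R = fcoef (fX ^+ k * g m') n.
  by rewrite fcoef_XnM /CHs; case: ifP.
apply: fpsP => n; rewrite -[LHS]/((CHR n m)%:R) CHR_rec !natrD !gs !expr1 3!fcoefD.
by congr (_ + _ + _ + _); case: (m == 0); case: n.
Qed.

Let rt m := fps_subX3 (r m).
Let gt m := fps_subX3 (g m).

(** As R = y^3/H, the coefficient of y^k in 1/H is that of y^(k+3) in R, whence the shift. The
    identity R H = y^3 is rederived from the recurrences, one power of y at a time. *)
Lemma pcoef_Hpoly m : pcoef (fun k => rt (k + 3)) m (Hpoly C) = (m == 0)%:R.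
Proof.
have gtE k : gt k = rt k + rt (k - 2) + rt (k + 2).
  by rewrite /gt gf_x_CH !fps_subX3D.
have rtE : rt m = (m == 0)%:R + fX ^+ 3 * gt (m - 1) + fX ^+ 3 * gt (m + 1)
    + (fX ^+ 3) ^+ 2 * gt m.
  rewrite {1}/rt gf_x_CHR !fps_subX3D expr2 -mulrA !fps_subX3_XM expr2 mulrA.
  congr (_ + _ + _ + _); case: (m == 0); first exact: fps_subX3_1.
  by apply: fpsP => n /=; case: ifP.
pose x : fps C := fX ^+ 3.
transitivity (rt m - x * gt (m - 1) - x * gt (m + 1) - x ^+ 2 * gt m); last first.
  by rewrite {1}rtE -/x; ring.
(* Monomials are repeated, not multiplied by 2, so that [pcoefXn] evaluates each of them. *)
have -> : Hpoly C = 'X^3 - x%:P * ('X^0 + 'X^2 + 'X^2 + 'X^4 + 'X^4 + 'X^6)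
    - (x ^+ 2)%:P * ('X^1 + 'X^3 + 'X^5) by rewrite /Hpoly /H -/x; ring.
rewrite !(pcoefB, pcoefCM, pcoefD, pcoefXn) !gtE.
have -> : m - 3%:Z + 3 = m by lia.
have -> : m - 0%:Z + 3 = m + 3 by lia.
have -> : m - 2%:Z + 3 = m + 1 by lia.
have -> : m - 4%:Z + 3 = m - 1 by lia.
have -> : m - 6%:Z + 3 = m - 3 by lia.
have -> : m - 1%:Z + 3 = m + 2 by lia.
have -> : m - 5%:Z + 3 = m - 2 by lia.
have -> : m - 1 - 2 = m - 3 by lia.
have -> : m - 1 + 2 = m + 1 by lia.
have -> : m + 1 - 2 = m - 1 by lia.
have -> : m + 1 + 2 = m + 3 by lia.
by ring.
Qed.

Lemma fps_subN_r0 : fps_subN (r 0) = r 0.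
Proof.
apply: fpsP => n /=; have [on|en] := boolP (odd n); last first.
  by rewrite -signr_odd (negPf en) mul1r.
by rewrite CHRE nvpathsR_parity ?mulr0//= addn0.
Qed.

Lemma fps_subN_Xg0 : fps_subN (fX * g 0) = - (fX * g 0).
Proof.
apply: fpsP => n; rewrite fcoefN -[LHS]/((-1) ^+ n * fcoef (fX * g 0) n) fcoef_XM.
case: n => [|n]; first by rewrite mulr0 oppr0.
have [on|en] := boolP (odd n); last by rewrite -signr_odd /= en mulN1r.
by rewrite /= CHE nvpaths_parity ?mulr0 ?oppr0//= addn0.
Qed.

Lemma fps_subND (f1 f2 : fps C) : fps_subN (f1 + f2) = fps_subN f1 + fps_subN f2.
Proof. by apply: fpsP => n /=; rewrite mulrDr. Qed.

(** The denominator of [Dterm] is the derivative of H in y, which makes [Dterm] a summand of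
    [residue_formula]. *)
Lemma Dterm_Hpoly (u : fps C) (N := 'X^2 + (fX ^+ 3)%:P * (1 + 'X^2 + 'X^4)) :
  Dterm xt u%:F = N.[u]%:F / ((Hpoly C)^`().[u])%:F.
Proof.
rewrite /N /Hpoly /Dterm /xt; move: (fX ^+ 3 : fps C) => x.
congr (_ / _).
  rewrite !(hornerD, hornerN, hornerM, hornerC, hornerX, horner_exp).
  by rewrite !(tofracD, tofracM, tofracXn, tofrac1).
have -> : H x%:P 'X = 'X^3 - x%:P * (1 + 'X^2 *+ 2 + 'X^4 *+ 2 + 'X^6)
    - (x ^+ 2)%:P * ('X + 'X^3 + 'X^5) by rewrite /H; ring.
have -> : ('X^3 - x%:P * (1 + 'X^2 *+ 2 + 'X^4 *+ 2 + 'X^6)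
    - (x ^+ 2)%:P * ('X + 'X^3 + 'X^5))^`().[u] =
   3 * u ^+ 2 - 2 * x * u * (2 + 4 * u ^+ 2 + 3 * u ^+ 4)
     - x ^+ 2 * (1 + 3 * u ^+ 2 + 5 * u ^+ 4).
  rewrite !(derivB, derivD, derivM, derivC, derivMn, derivXn, derivX) /=.
  rewrite !(hornerD, hornerN, hornerM, hornerC, hornerX, horner_exp, hornerMn) /=.
  by ring.
have natF n : (n%:R : fps C)%:F = n%:R :> fls C by rewrite rmorph_nat.
by rewrite !(tofracB, tofracD, tofracM, tofracXn, natF, tofrac1).
Qed.

Lemma constant_terms (s1 s2 s3 : fls C) : the_finite_roots s1 s2 s3 ->
  exists D : fps C,
    [/\ (fps_subX3 D)%:F = Dterm xt s1 + Dterm xt s2 + Dterm xt s3,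
        (gf_x C (fun n => CHR n 0))%:F = (D%:F + (fps_subN D)%:F) / 2
      & (gf_x C (fun n => CH n 0))%:F = (D%:F - (fps_subN D)%:F) / (2 * fX%:F)].
Proof.
move=> [us sP].
have root_fps s : s \in [:: s1; s2; s3] -> exists2 u : fps C, s = u%:F & H (fX ^+ 3) u = 0.
  by move=> /sP[Hs [u su]]; exists u => //; apply/H_tofrac_eq0; rewrite -su.
have [|u1 e1 H1] := root_fps s1; first by rewrite !inE eqxx.
have [|u2 e2 H2] := root_fps s2; first by rewrite !inE eqxx orbT.
have [|u3 e3 H3] := root_fps s3; first by rewrite !inE eqxx !orbT.
have uu : uniq [:: u1; u2; u3] by move: us; rewrite e1 e2 e3 /= !inE !tofrac_eq.
have [|u0 [V hV]] := Hpoly_factor uu.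
  by move=> u; rewrite !inE => /or3P[]/eqP->.
(* The coefficient of y^-1 in N/H, with x not yet replaced by t^3. *)
exists (r 0 + fX * g 0).
have -> : gf_x C (fun n => CHR n 0) = r 0 by [].
have -> : gf_x C (fun n => CH n 0) = g 0 by [].
have F2 : 2 != 0 :> fls C.
  rewrite -(rmorph_nat (@FracField.tofrac (fps C))) tofrac_eq0.
  apply/eqP => /(congr1 (@fps0 C)) /eqP.
  by rewrite rmorph_nat rmorph0 pnatr_eq0.
have FX : fX%:F != 0 :> fls C.
  rewrite tofrac_eq0; apply/eqP => /(congr1 (fun f => fcoef f 1)) /eqP.
  by rewrite oner_eq0.
split.
- rewrite e1 e2 e3 !Dterm_Hpoly -(residue_formula pcoef_Hpoly u0 uu hV erefl).
  congr (_%:F); rewrite fps_subX3D fps_subX3_XM gf_x_CH !fps_subX3D.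
  rewrite !(pcoefD, pcoefCM, pcoefXn, pcoef1).
  (* At index -1 and with the shift by 3, the monomials 1, y^2, y^4 select [rt 2], [rt 0],
     [rt (-2)]. *)
  rewrite -[LHS]/(rt 0 + fX ^+ 3 * (rt 0 + rt (-2) + rt 2)).
  by rewrite -[RHS]/(rt 0 + fX ^+ 3 * (rt 2 + rt 0 + rt (-2))); ring.
- rewrite fps_subND fps_subN_r0 fps_subN_Xg0 -tofracD.
  have -> : r 0 + fX * g 0 + (r 0 - fX * g 0) = 2 * r 0 by ring.
  by rewrite tofracM rmorph_nat mulrC mulKf.
- rewrite fps_subND fps_subN_r0 fps_subN_Xg0 -tofracB.
  have -> : r 0 + fX * g 0 - (r 0 - fX * g 0) = 2 * fX * g 0 by ring.
  by rewrite !tofracM rmorph_nat mulrC mulKf// mulf_neq0.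
Qed.

End ConstantTerms.

Theorem theorem23 (C : numClosedFieldType) :
  (let x : fps (laurent int) := fX in
   let y : fps (laurent int) := fconst (lmono 1 1) in
   gf_xy CHR = y ^+ 3 / H x y
   /\ gf_xy CH = y * (1 + y ^+ 2 + y ^+ 4) / H x y)
  /\ (exists s1 s2 s3 : fls C,
        the_finite_roots s1 s2 s3
        /\ [/\ vanishes_at0 s1, vanishes_at0 s2 & vanishes_at0 s3])
  /\ (forall s1 s2 s3 : fls C, the_finite_roots s1 s2 s3 ->
        exists D : fps C,
          [/\ (fps_subX3 D)%:F = Dterm xt s1 + Dterm xt s2 + Dterm xt s3,
              (gf_x C (fun n => CHR n 0))%:F
                = (D%:F + (fps_subN D)%:F) / 2
            & (gf_x C (fun n => CH n 0))%:F
                = (D%:F - (fps_subN D)%:F) / (2 * fX%:F)]).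
Proof.
split; first exact: gf_xy_rational.
split; first exact: finite_roots_exist.
exact: constant_terms.
Qed.
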